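(* Let $m\geq 1$ be an integer and let $\{R_i\}_{i=1,\dots,m}$ be a family of commutative rings with identity. Then $$\mathrm{G\text{-}gldim}\Big(\prod_{i=1}^m R_i\Big)=\sup\{\mathrm{G\text{-}gldim}(R_i)\mid 1\leq i\leq m\}.$$
   Context: All rings are commutative with identity and all modules are unital; no Noetherian hypothesis is assumed. An $R$-module $M$ is Gorenstein projective if there is an exact sequence of projective $R$-modules $\mathbf P=\cdots\to P_1\to P_0\to P^0\to P^1\to\cdots$ with $M\cong \mathrm{Im}(P_0\to P^0)$ such that $\mathrm{Hom}_R(\mathbf P,Q)$ is exact for every projective $R$-module $Q$. The Gorenstein projective dimension $\mathrm{Gpd}_R(M)$ is the least integer $k\ge 0$ such that there is an exact sequence $0\to G_k\to\cdots\to G_0\to M\to 0$ with all $G_i$ Gorenstein projective ($\infty$ if no such $k$ exists). Gorenstein injective modules and the Gorenstein injective dimension $\mathrm{Gid}_R(M)$ are defined dually. The Gorenstein global dimension of $R$ is $\mathrm{G\text{-}gldim}(R)=\sup\{\mathrm{Gpd}_R(M)\mid M \text{ an } R\text{-module}\}$ (possibly $\infty$); it is known that this equals $\sup\{\mathrm{Gid}_R(M)\mid M \text{ an } R\text{-module}\}$ for every ring $R$. *)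

(* Defs.v *)
From HB Require Import structures.
From mathcomp Require Import all_boot all_order all_algebra.
From mathcomp Require Import boolp classical_sets constructive_ereal.

Set Implicit Arguments.
Unset Strict Implicit.
Unset Printing Implicit Defensive.

Import Order.TTheory GRing.Theory Num.Theory.
Local Open Scope ring_scope.
Local Open Scope classical_set_scope.

(* Componentwise ring structure on a finite dependent product; the library only
   provides the non-dependent power {ffun I -> R}. *)
Section ProductRing.
Variables (I : finType) (R : I -> comPzRingType).
Implicit Types f g h : {dffun forall i, R i}.

Definition dffun_zero : {dffun forall i, R i} := [ffun i => 0 : R i].
Definition dffun_opp f : {dffun forall i, R i} := [ffun i => - f i].
Definition dffun_add f g : {dffun forall i, R i} := [ffun i => f i + g i].
Definition dffun_one : {dffun forall i, R i} := [ffun i => 1 : R i].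
Definition dffun_mul f g : {dffun forall i, R i} := [ffun i => f i * g i].

Lemma dffun_addA : associative dffun_add.
Proof. by move=> f g h; apply/ffunP => i; rewrite !ffunE addrA. Qed.
Lemma dffun_addC : commutative dffun_add.
Proof. by move=> f g; apply/ffunP => i; rewrite !ffunE addrC. Qed.
Lemma dffun_add0 : left_id dffun_zero dffun_add.
Proof. by move=> f; apply/ffunP => i; rewrite !ffunE add0r. Qed.
Lemma dffun_addN : left_inverse dffun_zero dffun_opp dffun_add.
Proof. by move=> f; apply/ffunP => i; rewrite !ffunE addNr. Qed.

HB.instance Definition _ := GRing.isZmodule.Build {dffun forall i, R i}
  dffun_addA dffun_addC dffun_add0 dffun_addN.

Lemma dffun_mulA : associative dffun_mul.
Proof. by move=> f g h; apply/ffunP => i; rewrite !ffunE mulrA. Qed.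
Lemma dffun_mulC : commutative dffun_mul.
Proof. by move=> f g; apply/ffunP => i; rewrite !ffunE mulrC. Qed.
Lemma dffun_mul1 : left_id dffun_one dffun_mul.
Proof. by move=> f; apply/ffunP => i; rewrite !ffunE mul1r. Qed.
Lemma dffun_mulDl : left_distributive dffun_mul dffun_add.
Proof. by move=> f g h; apply/ffunP => i; rewrite !ffunE mulrDl. Qed.

HB.instance Definition _ := GRing.Zmodule_isComPzRing.Build
  {dffun forall i, R i} dffun_mulA dffun_mulC dffun_mul1 dffun_mulDl.

End ProductRing.

Section GorensteinDimension.
Variable R : comPzRingType.
Implicit Types M Q : lmodType R.

Definition projective Q : Prop :=
  forall (A B : lmodType R) (g : {linear A -> B}) (f : {linear Q -> B}),
    (forall b, exists a, g a = b) ->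
    exists h : {linear Q -> A}, forall x, g (h x) = f x.

Definition exact_at (A B C : lmodType R) (f : {linear A -> B})
    (g : {linear B -> C}) : Prop :=
  forall b, g b = 0 <-> exists a, f a = b.

(* Exactness of Hom(C, Q) -> Hom(B, Q) -> Hom(A, Q) at the middle term. *)
Definition hom_exact_at (A B C : lmodType R) (f : {linear A -> B})
    (g : {linear B -> C}) Q : Prop :=
  forall phi : {linear B -> Q},
    (forall a, phi (f a) = 0) <->
    exists psi : {linear C -> Q}, forall b, psi (g b) = phi b.

(* The doubly infinite complex is indexed cohomologically by int: P_i is P (- i)
   and P^i is P (i + 1), so that P_0 -> P^0 is d 0.  The map j identifies M with
   the image of d 0. *)
Definition Gorenstein_projective M : Prop :=
  exists (P : int -> lmodType R) (d : forall n, {linear P n -> P (n + 1)})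
         (j : {linear M -> P (0 + 1)}),
    [/\ forall n, projective (P n),
        forall n, exact_at (d n) (d (n + 1)),
        forall Q, projective Q -> forall n, hom_exact_at (d n) (d (n + 1)) Q,
        injective j
      & forall y, (exists x, j x = y) <-> (exists x, d 0 x = y)].

(* An exact sequence 0 -> G_k -> ... -> G_0 -> M -> 0 with Gorenstein projective
   terms, continued by zero modules to the left of G_k. *)
Definition has_Gproj_resolution (k : nat) M : Prop :=
  exists (G : nat -> lmodType R) (d : forall i, {linear G i.+1 -> G i})
         (e : {linear G 0%N -> M}),
    [/\ forall i, (i <= k)%N -> Gorenstein_projective (G i),
        forall i, (k < i)%N -> forall x : G i, x = 0,
        forall y, exists x, e x = y,
        exact_at (d 0%N) e
      & forall i, exact_at (d i.+1) (d i)].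

(* Dimensions live in \bar int, where infimum +oo of a set of naturals is its
   least element, or +oo if the set is empty. *)
Definition Gpd M : \bar int :=
  infimum +oo%E [set (k%:Z)%:E | k in [set k | has_Gproj_resolution k M]].

Definition Ggldim : \bar int :=
  supremum -oo%E [set x | exists M : lmodType R, Gpd M = x].

End GorensteinDimension.

(* Main.v *)
(** A module over the product S of the R_i is the same thing as a family of
    modules over the R_i.  Let e_i be the idempotent of the i-th factor.  The
    component functor N |-> e_i N, from S-modules to R_i-modules, is exact and is
    both left and right adjoint to restriction of scalars along S -> R_i, which
    is exact too; so both preserve projective modules, and taking components
    preserves Hom-exactness, hence Gorenstein projective modules and their
    resolutions.  Conversely a family of such resolutions of length k assembles
    into one over S, and N is the product of the e_i N.  Hence all S-modules have
    Gorenstein projective resolutions of length k if and only if all R_i-modules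
    do, for every i; a dimension is determined by the naturals k bounding it. *)

Require Import Defs.
From HB Require Import structures.
From mathcomp Require Import all_boot all_order all_algebra.
From mathcomp Require Import boolp classical_sets constructive_ereal.

Set Implicit Arguments.
Unset Strict Implicit.
Unset Printing Implicit Defensive.

Import Order.TTheory GRing.Theory Num.Theory.
Local Open Scope ring_scope.

Definition linear_of (R : comPzRingType) (A B : lmodType R) (f : A -> B)
  (fL : linear f) : {linear A -> B} :=
  HB.pack f (GRing.isLinear.Build R A B *:%R f fL).

(** Serves to choose lifts, complexes and resolutions for all factors at once. *)
Lemma dep_choice (I : Type) (T : I -> Type) (P : forall i, T i -> Prop) :
  (forall i, exists x, P i x) -> exists f, forall i, P i (f i).
Proof. by move=> PT; exists (fun i => sval (cid (PT i))) => i; case: cid. Qed.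

(** * Lengthening a resolution and transporting it along an isomorphism *)

Section ModuleTransport.
Variable R : comPzRingType.
Implicit Types M N : lmodType R.

(** The complex that is the zero module in every degree does it. This is what makes padding a
    resolution with zeros legitimate. *)
Lemma Gproj_trivial M : (forall x : M, x = 0) -> Gorenstein_projective M.
Proof.
move=> M0; exists (fun=> M), (fun=> \0 : {linear M -> M}), idfun.
have Meq (x y : M) : x = y by rewrite (M0 x) (M0 y).
split.
- move=> _ A B g f _; exists (\0 : {linear M -> A}) => x.
  by rewrite (M0 x) !linear0.
- by move=> n b; split=> // _; exists 0; exact: Meq.
- move=> Q _ n phi; split=> [_|_ a]; last by rewrite linear0.
  by exists phi => b; congr (phi _); exact: Meq.
- by [].
- by move=> y; split=> _; exists 0; exact: Meq.
Qed.

(** The resolution itself is unchanged: its terms in degrees above [k] are zero, hence Gorenstein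
    projective. *)
Lemma resolution_monotone M k l : (k <= l)%N ->
  has_Gproj_resolution k M -> has_Gproj_resolution l M.
Proof.
move=> le_kl [G [d [e [GP G0 eS ex exd]]]]; exists G, d, e; split=> //.
- move=> i le_il; have [/GP//|/G0 Gi0] := leqP i k.
  exact: Gproj_trivial.
- by move=> i lt_li; apply: G0; apply: leq_ltn_trans lt_li.
Qed.

Lemma resolution_iso M N k (t : {linear M -> N}) :
  injective t -> (forall y, exists x, t x = y) ->
  has_Gproj_resolution k M -> has_Gproj_resolution k N.
Proof.
move=> t_inj t_surj [G [d [e [GP G0 eS ex exd]]]].
exists G, d, (t \o e : {linear G 0%N -> N}); split=> //.
- by move=> y; have [x <-] := t_surj y; have [z <-] := eS x; exists z.
- move=> b /=; split=> [tb0|/ex ->]; last by rewrite linear0.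
  by apply/ex/t_inj; rewrite linear0.
Qed.

End ModuleTransport.

(** * The orthogonal idempotents of the product ring *)

Section Product.
Variables (I : finType) (R : I -> comPzRingType).
Local Notation S := {dffun forall i, R i}.

(** The inclusion of the [i]-th factor as an ideal: additive and multiplicative, but [1] goes to the
    idempotent [e i], in general not to [1]. *)
Definition ring_inj i (r : R i) : S := finfun (dfwith (fun j => 0 : R j) r).

Lemma ring_injE i (r : R i) : ring_inj r i = r.
Proof. by rewrite ffunE dfwith_in. Qed.

Lemma ring_inj_out i j (r : R i) : i != j -> ring_inj r j = 0.
Proof. by move=> ij; rewrite ffunE dfwith_out. Qed.

Lemma ring_addE (s t : S) i : (s + t) i = s i + t i.
Proof. by rewrite ffunE. Qed.

Lemma ring_mulE (s t : S) i : (s * t) i = s i * t i.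
Proof. by rewrite ffunE. Qed.

Lemma ring_oneE i : (1 : S) i = 1.
Proof. by rewrite ffunE. Qed.

Lemma ring_zeroE i : (0 : S) i = 0.
Proof. by rewrite ffunE. Qed.

Lemma ring_injD i : {morph @ring_inj i : r s / r + s}.
Proof.
move=> r s; apply/ffunP => j; rewrite ring_addE.
have [<-|ij] := eqVneq i j; first by rewrite !ring_injE.
by rewrite !ring_inj_out // addr0.
Qed.

Lemma ring_injMr i (r : R i) (s : S) : ring_inj r * s = ring_inj (r * s i).
Proof.
apply/ffunP => j; rewrite ring_mulE.
have [<-|ij] := eqVneq i j; first by rewrite !ring_injE.
by rewrite !ring_inj_out // mul0r.
Qed.

Lemma ring_injM i : {morph @ring_inj i : r s / r * s}.
Proof. by move=> r s; rewrite ring_injMr ring_injE. Qed.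

(** Here the finiteness of [I] enters. Applied to an element of an [S]-module, this identity splits
    it into its components. *)
Lemma sum_ring_inj1 : \sum_i ring_inj (1 : R i) = 1.
Proof.
have sumE (F : I -> S) j : (\sum_i F i) j = \sum_i F i j.
  exact: (big_morph (fun s : S => s j) (fun s t => ring_addE s t j)
            (ring_zeroE j)).
apply/ffunP => j; rewrite sumE (bigD1 j) //= ring_injE big1 ?addr0 ?ring_oneE //.
by move=> i ij; rewrite ring_inj_out.
Qed.

Local Notation e i := (ring_inj (1 : R i)).

Lemma idem_mul i (s : S) : e i * s = ring_inj (s i).
Proof. by rewrite ring_injMr mul1r. Qed.

(** * The component at i of a module over the product *)

Section Component.
Variable i : I.

(** As [e i] is idempotent, its image in [N] is its set of fixed points; the boolean equation allows
    a subtype. *)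
Definition component_pred (N : lmodType S) : {pred N} :=
  fun x => e i *: x == x.
Arguments component_pred : clear implicits.

Record component (N : lmodType S) : Type :=
  Component { component_val : N; _ : component_val \in component_pred N }.

HB.instance Definition _ (N : lmodType S) := [isSub for @component_val N].
HB.instance Definition _ (N : lmodType S) := [Choice of component N by <:].

Lemma component_zmod_closed N : zmod_closed (component_pred N).
Proof.
split=> [|x y /eqP ex /eqP ey]; rewrite unfold_in; first by rewrite scaler0.
by rewrite scalerBr ex ey.
Qed.

HB.instance Definition _ (N : lmodType S) :=
  GRing.isZmodClosed.Build N (component_pred N) (component_zmod_closed N).
HB.instance Definition _ (N : lmodType S) :=
  [SubChoice_isSubZmodule of component N by <:].

Lemma component_scale_subproof N (r : R i) (x : component N) :
  ring_inj r *: val x \in component_pred N.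
Proof. by rewrite unfold_in scalerA -ring_injM mul1r. Qed.

(** Although [ring_inj] need not preserve [1], this action is unital, because [e i] acts as the
    identity on the component. *)
Definition component_scale N (r : R i) (x : component N) : component N :=
  Component (component_scale_subproof r x).

Lemma idem_component N (x : component N) : e i *: val x = val x.
Proof. exact/eqP/(valP x). Qed.

Lemma component_scaleA N (a b : R i) (x : component N) :
  component_scale a (component_scale b x) = component_scale (a * b) x.
Proof. by apply: val_inj; rewrite /= scalerA -ring_injM. Qed.

Lemma component_scale1 N : left_id 1 (@component_scale N).
Proof. by move=> x; apply: val_inj; exact: idem_component. Qed.

Lemma component_scaleDr N : right_distributive (@component_scale N) +%R.
Proof. by move=> a x y; apply: val_inj; rewrite /= scalerDr. Qed.

Lemma component_scaleDl N (x : component N) :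
  {morph (@component_scale N)^~ x : a b / a + b}.
Proof. by move=> a b; apply: val_inj; rewrite /= ring_injD scalerDl. Qed.

HB.instance Definition _ (N : lmodType S) :=
  GRing.Zmodule_isLmodule.Build (R i) (component N)
  (@component_scaleA N) (@component_scale1 N) (@component_scaleDr N)
  (@component_scaleDl N).

Lemma component_valZ N (r : R i) (x : component N) :
  val (r *: x) = ring_inj r *: val x.
Proof. by []. Qed.

Lemma component_valD N (x y : component N) : val (x + y) = val x + val y.
Proof. by []. Qed.

(** Since [e i * s = ring_inj (s i)], the ring [S] acts on the component through the [i]-th
    coordinate only. *)
Lemma component_val_scale N (s : S) (x : component N) :
  s *: val x = val (s i *: x).
Proof.
by rewrite component_valZ -idem_mul mulrC -scalerA idem_component.
Qed.

Lemma idem_in_component (N : lmodType S) (x : N) :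
  e i *: x \in component_pred N.
Proof. by rewrite unfold_in scalerA -ring_injM mul1r. Qed.

Definition component_proj (N : lmodType S) (x : N) : component N :=
  Component (idem_in_component x).

Lemma component_projD N : {morph @component_proj N : x y / x + y}.
Proof. by move=> x y; apply: val_inj; rewrite /= scalerDr. Qed.

Lemma component_projZ (N : lmodType S) (s : S) (x : N) :
  component_proj (s *: x) = s i *: component_proj x.
Proof.
apply: val_inj; rewrite component_valZ /= !scalerA idem_mul -ring_injM.
by rewrite mulr1.
Qed.

Lemma component_valK N : cancel val (@component_proj N).
Proof. by move=> x; apply: val_inj; exact: idem_component. Qed.

Section Map.
Variables (A B : lmodType S) (f : {linear A -> B}).

Lemma component_map_subproof (x : component A) :
  f (val x) \in component_pred B.
Proof. by rewrite unfold_in -linearZ idem_component. Qed.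

Definition component_map_fun (x : component A) : component B :=
  Component (component_map_subproof x).

Lemma component_map_linear : linear component_map_fun.
Proof. by move=> r x y; apply: val_inj; rewrite /= linearP. Qed.

Definition component_map : {linear component A -> component B} :=
  linear_of component_map_linear.

Lemma component_mapE x : val (component_map x) = f (val x).
Proof. by []. Qed.

Lemma component_map_proj x :
  component_map (component_proj x) = component_proj (f x).
Proof. by apply: val_inj; rewrite /= linearZ. Qed.

(** A preimage [x] of [val y] can be replaced by [e i *: x], as [f] commutes with [e i] and [e i]
    fixes [val y]. Surjectivity and exactness on components come from this. *)
Lemma component_map_image y :
  (exists x, component_map x = y) <-> (exists x, f x = val y).
Proof.
split=> [[x <-]|[x fxy]]; first by exists (val x).
by exists (component_proj x); rewrite component_map_proj fxy component_valK.
Qed.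

Lemma component_map_inj : injective f -> injective component_map.
Proof. by move=> fI x y /(congr1 val) /fI; exact: val_inj. Qed.

Lemma component_map_surj :
  (forall y, exists x, f x = y) -> forall y, exists x, component_map x = y.
Proof. by move=> fS y; apply/component_map_image. Qed.

End Map.

Lemma component_exact (A B C : lmodType S) (f : {linear A -> B})
    (g : {linear B -> C}) :
  exact_at f g -> exact_at (component_map f) (component_map g).
Proof.
move=> fg b; rewrite component_map_image -fg -component_mapE.
by split=> [->//|gb0]; apply: val_inj.
Qed.

(** * Restriction of scalars along the i-th projection *)

(** An alias of [M], so that the action of [S] gets a carrier distinct from the one with the action
    of [R i]. *)
Definition restriction (M : lmodType (R i)) : Type := M.

HB.instance Definition _ (M : lmodType (R i)) := GRing.Zmodule.on (restriction M).

Definition restriction_scale M (s : S) (x : restriction M) : restriction M :=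
  s i *: (x : M).

Lemma restriction_scaleA (M : lmodType (R i)) (a b : S) (x : restriction M) :
  restriction_scale a (restriction_scale b x) = restriction_scale (a * b) x.
Proof. by rewrite /restriction_scale scalerA ring_mulE. Qed.

Lemma restriction_scale1 (M : lmodType (R i)) : left_id 1 (@restriction_scale M).
Proof. by move=> x; rewrite /restriction_scale ring_oneE scale1r. Qed.

Lemma restriction_scaleDr (M : lmodType (R i)) :
  right_distributive (@restriction_scale M) +%R.
Proof. by move=> a x y; rewrite /restriction_scale scalerDr. Qed.

Lemma restriction_scaleDl (M : lmodType (R i)) (x : restriction M) :
  {morph (@restriction_scale M)^~ x : a b / a + b}.
Proof. by move=> a b; rewrite /restriction_scale ring_addE scalerDl. Qed.

HB.instance Definition _ (M : lmodType (R i)) :=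
  GRing.Zmodule_isLmodule.Build S (restriction M)
  (@restriction_scaleA M) (@restriction_scale1 M) (@restriction_scaleDr M)
  (@restriction_scaleDl M).

Lemma restriction_map_linear (A B : lmodType (R i)) (f : {linear A -> B}) :
  linear (f : restriction A -> restriction B).
Proof. by move=> s x y; exact: linearP. Qed.

Definition restriction_map A B f := linear_of (@restriction_map_linear A B f).

(** Four transposes follow. [to_restriction] and [of_restriction] exhibit the component as left
    adjoint to restriction, [restriction_from] and [restriction_into] as right adjoint. *)
Lemma to_restriction_linear (N : lmodType S) (M : lmodType (R i))
    (f : {linear component N -> M}) :
  linear (fun x : N => f (component_proj x) : restriction M).
Proof.
by move=> s x y; rewrite component_projD component_projZ; exact: linearP.
Qed.

Definition to_restriction N M f := linear_of (@to_restriction_linear N M f).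

Lemma restriction_from_linear (N : lmodType S) (M : lmodType (R i))
    (f : {linear M -> component N}) :
  linear (fun x : restriction M => val (f x)).
Proof.
move=> s x y; rewrite component_val_scale -component_valD -linearP.
by [].
Qed.

Definition restriction_from N M f := linear_of (@restriction_from_linear N M f).

Lemma of_restriction_linear (N : lmodType S) (M : lmodType (R i))
    (f : {linear N -> restriction M}) :
  linear (fun x : component N => f (val x) : M).
Proof.
move=> r x y; rewrite /= linearP /=; congr (_ + _).
by rewrite {1}/GRing.scale /= /restriction_scale ring_injE.
Qed.

Definition of_restriction N M f := linear_of (@of_restriction_linear N M f).

Lemma restriction_into_linear (N : lmodType S) (M : lmodType (R i))
    (f : {linear restriction M -> N}) :
  linear (fun x : M => component_proj (f x)).
Proof.
(* Writing [r] as the [i]-th coordinate of [ring_inj r] turns its action on [M] into an action of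
   [S] on [restriction M], where [f] is linear. *)
move=> r x y; rewrite -[r in LHS](ring_injE r).
have -> : ring_inj r i *: x + y = ring_inj r *: (x : restriction M) + y :> M.
  by [].
by rewrite linearP component_projD component_projZ ring_injE.
Qed.

Definition restriction_into N M f := linear_of (@restriction_into_linear N M f).

(** The idempotent [e i] fixes [restriction M], so [f] already takes values in the component and
    projecting loses nothing. *)
Lemma restriction_in_component (N : lmodType S) (M : lmodType (R i))
    (f : {linear restriction M -> N}) x : val (restriction_into f x) = f x.
Proof.
rewrite /= -linearZ; congr (f _).
by rewrite /GRing.scale /= /restriction_scale ring_injE scale1r.
Qed.

(** The component is left adjoint to restriction, which keeps [g] surjective because the underlying
    function is the same. *)
Lemma projective_component (Q : lmodType S) :
  projective Q -> projective (component Q).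
Proof.
move=> Qproj A B g f gS.
have [h hE] := Qproj _ _ (restriction_map g) (to_restriction f) gS.
exists (of_restriction h) => x; rewrite -[in RHS](component_valK x).
exact: hE.
Qed.

(** Restriction is left adjoint to the component, which preserves surjections. *)
Lemma projective_restriction (Q : lmodType (R i)) :
  projective Q -> projective (restriction Q).
Proof.
move=> Qproj A B g f gS.
have [h hE] := Qproj _ _ (component_map g) (restriction_into f)
  (component_map_surj gS).
exists (restriction_from h) => x.
by rewrite -[RHS]restriction_in_component -hE.
Qed.

(** By adjunction, maps from components to [Q] are [S]-linear maps from the original modules to
    [restriction Q]. *)
Lemma component_hom_exact (A B C : lmodType S) (f : {linear A -> B})
    (g : {linear B -> C}) (Q : lmodType (R i)) :
  hom_exact_at f g (restriction Q) ->
  hom_exact_at (component_map f) (component_map g) Q.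
Proof.
move=> fgQ phi; split=> [phif0|[psi psiE] a].
  have [|psi psiE] := (fgQ (to_restriction phi)).1.
    by move=> a; rewrite -[RHS](phif0 (component_proj a)) component_map_proj.
  exists (of_restriction psi) => b; rewrite -[in RHS](component_valK b).
  exact: psiE.
rewrite -(component_valK (component_map f a)).
apply: ((fgQ (to_restriction phi)).2) (val a).
exists (to_restriction psi) => b.
by rewrite /= -component_map_proj psiE.
Qed.

Lemma Gproj_component (M : lmodType S) :
  Gorenstein_projective M -> Gorenstein_projective (component M).
Proof.
move=> [P [d [j [Pproj dex dhom jI jim]]]].
exists (fun n => component (P n)), (fun n => component_map (d n)),
  (component_map j); split.
- by move=> n; exact: projective_component.
- by move=> n; exact: component_exact.
- move=> Q Qproj n; apply: component_hom_exact; apply: dhom.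
  exact: projective_restriction.
- exact: component_map_inj.
- by move=> y; rewrite !component_map_image.
Qed.

Lemma resolution_component k (M : lmodType S) :
  has_Gproj_resolution k M -> has_Gproj_resolution k (component M).
Proof.
move=> [G [d [p [GP G0 pS pex dex]]]].
exists (fun n => component (G n)), (fun n => component_map (d n)),
  (component_map p); split.
- by move=> n /GP; exact: Gproj_component.
- by move=> n /G0 Gn0 x; apply: val_inj; exact: Gn0.
- exact: component_map_surj.
- exact: component_exact.
- by move=> n; exact: component_exact.
Qed.

(** Restricting and then taking the component gives [M] back: the counit [t] is bijective, since
    [e i] acts as the identity on [restriction M]. *)
Lemma resolution_restriction k (M : lmodType (R i)) :
  has_Gproj_resolution k (restriction M) -> has_Gproj_resolution k M.
Proof.
move/resolution_component.
pose t := of_restriction (idfun : {linear restriction M -> restriction M}).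
apply: (@resolution_iso _ _ _ _ t) => [x y|y]; first exact: val_inj.
exists (component_proj (y : restriction M)).
by rewrite /= {1}/GRing.scale /= /restriction_scale ring_injE scale1r.
Qed.

End Component.
Arguments component_pred : clear implicits.

(** * Product of a family of modules *)

Section ProductModule.
Variable M : forall i, lmodType (R i).

(** A constant of its own to carry the [S]-module structure, as dependent finite functions already
    carry the product ring structure. *)
Definition product_module : Type := {dffun forall i, M i}.

HB.instance Definition _ := Choice.on product_module.

Implicit Types x y z : product_module.

Definition product_zero : product_module := [ffun i => 0 : M i].
Definition product_opp x : product_module := [ffun i => - x i].
Definition product_add x y : product_module := [ffun i => x i + y i].
Definition product_scale (s : S) x : product_module := [ffun i => s i *: x i].

Lemma product_addA : associative product_add.
Proof. by move=> x y z; apply/ffunP => i; rewrite !ffunE addrA. Qed.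
Lemma product_addC : commutative product_add.
Proof. by move=> x y; apply/ffunP => i; rewrite !ffunE addrC. Qed.
Lemma product_add0 : left_id product_zero product_add.
Proof. by move=> x; apply/ffunP => i; rewrite !ffunE add0r. Qed.
Lemma product_addN : left_inverse product_zero product_opp product_add.
Proof. by move=> x; apply/ffunP => i; rewrite !ffunE addNr. Qed.

HB.instance Definition _ := GRing.isZmodule.Build product_module
  product_addA product_addC product_add0 product_addN.

Lemma product_scaleA a b x :
  product_scale a (product_scale b x) = product_scale (a * b) x.
Proof. by apply/ffunP => i; rewrite !ffunE scalerA. Qed.
Lemma product_scale1 : left_id 1 product_scale.
Proof. by move=> x; apply/ffunP => i; rewrite !ffunE scale1r. Qed.
Lemma product_scaleDr : right_distributive product_scale +%R.
Proof. by move=> a x y; apply/ffunP => i; rewrite !ffunE scalerDr. Qed.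
Lemma product_scaleDl x : {morph product_scale^~ x : a b / a + b}.
Proof. by move=> a b; apply/ffunP => i; rewrite !ffunE scalerDl. Qed.

HB.instance Definition _ := GRing.Zmodule_isLmodule.Build S product_module
  product_scaleA product_scale1 product_scaleDr product_scaleDl.

Lemma product_addE x y i : (x + y) i = x i + y i.
Proof. by rewrite ffunE. Qed.

Lemma product_scaleE (s : S) x i : (s *: x) i = s i *: x i.
Proof. by rewrite ffunE. Qed.

Lemma product_zeroE i : (0 : product_module) i = 0.
Proof. by rewrite ffunE. Qed.

Definition module_inj i (a : M i) : product_module :=
  finfun (dfwith (fun j => 0 : M j) a).

Lemma module_injE i (a : M i) : module_inj a i = a.
Proof. by rewrite ffunE dfwith_in. Qed.

Lemma module_inj_out i j (a : M i) : i != j -> module_inj a j = 0.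
Proof. by move=> ij; rewrite ffunE dfwith_out. Qed.

Lemma ring_inj_scale i (r : R i) x : ring_inj r *: x = module_inj (r *: x i).
Proof.
apply/ffunP => j; rewrite product_scaleE; have [<-|ij] := eqVneq i j.
  by rewrite ring_injE module_injE.
by rewrite ring_inj_out // module_inj_out // scale0r.
Qed.

Lemma module_injD i : {morph @module_inj i : a b / a + b}.
Proof.
move=> a b; apply/ffunP => j; rewrite product_addE; have [<-|ij] := eqVneq i j.
  by rewrite !module_injE.
by rewrite !module_inj_out // addr0.
Qed.

Lemma module_injZ i (r : R i) a :
  module_inj (r *: a) = ring_inj r *: module_inj a.
Proof. by rewrite ring_inj_scale module_injE. Qed.

Lemma sum_module_inj x : \sum_i module_inj (x i) = x.
Proof.
rewrite -[RHS]scale1r -sum_ring_inj1 scaler_suml; apply: eq_bigr => i _.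
by rewrite ring_inj_scale scale1r.
Qed.

Section Maps.
Variable N : lmodType S.

(** The index type being finite, the product is also a coproduct: [copair] and [corestriction] pass
    between families of maps from [M i] to [component i N] and single maps from the product to
    [N]. *)
Lemma copair_linear (f : forall i, {linear M i -> component i N}) :
  linear (fun x : product_module => \sum_i val (f i (x i))).
Proof.
move=> s x y; rewrite scaler_sumr -big_split /=; apply: eq_bigr => i _.
rewrite component_val_scale -component_valD -linearP.
by rewrite product_addE product_scaleE.
Qed.

Definition copair f := linear_of (copair_linear f).

Lemma copair_inj f i (a : M i) : copair f (module_inj a) = val (f i a).
Proof.
rewrite /= (bigD1 i) //= module_injE big1 ?addr0 // => j ij.
by rewrite module_inj_out 1?eq_sym // linear0.
Qed.

Lemma linear_sum_inj (f : {linear product_module -> N}) x :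
  f x = \sum_i f (module_inj (x i)).
Proof. by rewrite -{1}(sum_module_inj x) linear_sum. Qed.

Lemma corestriction_subproof (f : {linear product_module -> N}) i (a : M i) :
  f (module_inj a) \in component_pred i N.
Proof. by rewrite unfold_in -linearZ -module_injZ scale1r. Qed.

Lemma corestriction_linear f i : linear (fun a : M i =>
  Component (corestriction_subproof f a) : component i N).
Proof.
by move=> r a b; apply: val_inj; rewrite /= module_injD module_injZ linearP.
Qed.

Definition corestriction f i := linear_of (corestriction_linear f (i:=i)).

Lemma corestrictionE f i a : val (corestriction f i a) = f (module_inj a).
Proof. by []. Qed.

End Maps.

(** Each [corestriction f i] lifts along the component of [g], and the lifts are glued by
    [copair]. *)
Lemma projective_product :
  (forall i, projective (M i)) -> projective product_module.
Proof.
move=> Mproj A B g f gS.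
have /dep_choice[h hE] i := Mproj i _ _ (component_map i g) (corestriction f i)
  (component_map_surj gS).
exists (copair h) => x; rewrite linear_sum linear_sum_inj.
by apply: eq_bigr => i _; rewrite -component_mapE hE.
Qed.

End ProductModule.

(** * Products of linear maps, complexes and resolutions *)

Section ProductMap.
Variables (A B : forall i, lmodType (R i)) (f : forall i, {linear A i -> B i}).

Lemma product_map_linear :
  linear (fun x : product_module A => [ffun i => f i (x i)] : product_module B).
Proof.
move=> s x y; apply/ffunP => i.
by rewrite product_addE product_scaleE !ffunE linearP.
Qed.

Definition product_map := linear_of product_map_linear.

Lemma product_mapE x i : product_map x i = f i (x i).
Proof. by rewrite ffunE. Qed.

Lemma product_map_inj i (a : A i) :
  product_map (module_inj a) = module_inj (f i a).
Proof.
apply/ffunP => j; rewrite product_mapE; have [<-|ij] := eqVneq i j.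
  by rewrite !module_injE.
by rewrite !module_inj_out // linear0.
Qed.

Lemma product_map_image y :
  (exists x, product_map x = y) <-> (forall i, exists x, f i x = y i).
Proof.
split=> [[x <-] i|/dep_choice[x xE]]; first by exists (x i); rewrite ffunE.
by exists (finfun x : product_module A); apply/ffunP => i; rewrite !ffunE xE.
Qed.

Lemma product_map_injective :
  (forall i, injective (f i)) -> injective product_map.
Proof.
move=> fI x y /ffunP xy; apply/ffunP => i; apply: fI.
by rewrite -!product_mapE xy.
Qed.

End ProductMap.

Lemma product_exact (A B C : forall i, lmodType (R i))
    (f : forall i, {linear A i -> B i}) (g : forall i, {linear B i -> C i}) :
  (forall i, exact_at (f i) (g i)) -> exact_at (product_map f) (product_map g).
Proof.
move=> fg b; rewrite product_map_image; split=> [gb0 i|fb].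
  by apply/fg; rewrite -product_mapE gb0 product_zeroE.
by apply/ffunP => i; rewrite product_mapE product_zeroE; apply/fg.
Qed.

(** A map from a product to [Q] amounts to its corestrictions, so exactness is tested for each [i]
    against [component i Q]. *)
Lemma product_hom_exact (A B C : forall i, lmodType (R i))
    (f : forall i, {linear A i -> B i}) (g : forall i, {linear B i -> C i})
    (Q : lmodType S) :
  (forall i, hom_exact_at (f i) (g i) (component i Q)) ->
  hom_exact_at (product_map f) (product_map g) Q.
Proof.
move=> fgQ phi; split=> [phif0|[psi psiE] a].
  have /dep_choice[psi psiE] i : exists psi : {linear C i -> component i Q},
      forall b, psi (g i b) = corestriction phi i b.
    apply/fgQ => a; apply: val_inj.
    by rewrite corestrictionE -product_map_inj phif0.
  exists (copair psi) => b; rewrite [RHS]linear_sum_inj.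
  by apply: eq_bigr => i _; rewrite product_mapE psiE.
rewrite linear_sum_inj big1 // => i _; rewrite product_mapE -corestrictionE.
have -> // : corestriction phi i (f i (a i)) = 0.
apply: (fgQ i (corestriction phi i)).2.
exists (corestriction psi i) => b; apply: val_inj.
by rewrite !corestrictionE -product_map_inj psiE.
Qed.

(** Complete resolutions are multiplied degreewise. A projective [Q] has projective components, so
    the factors' Hom-exactness applies to them. *)
Lemma Gproj_product (M : forall i, lmodType (R i)) :
  (forall i, Gorenstein_projective (M i)) ->
  Gorenstein_projective (product_module M).
Proof.
move=> /dep_choice[P] /dep_choice[d] /dep_choice[j] dj.
exists (fun n => product_module (fun i => P i n)),
  (fun n => product_map (fun i => d i n)), (product_map j); split.
- by move=> n; apply: projective_product => i; have [] := dj i.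
- by move=> n; apply: product_exact => i; have [] := dj i.
- move=> Q Qproj n; apply: product_hom_exact => i.
  by have [_ _ dhom _ _] := dj i; apply: dhom; exact: projective_component.
- by apply: product_map_injective => i; have [] := dj i.
- move=> y; rewrite !product_map_image.
  by split=> jd i; have [_ _ _ _ jim] := dj i; apply/jim.
Qed.

Lemma resolution_product k (M : forall i, lmodType (R i)) :
  (forall i, has_Gproj_resolution k (M i)) ->
  has_Gproj_resolution k (product_module M).
Proof.
move=> /dep_choice[G] /dep_choice[d] /dep_choice[p] dp.
exists (fun n => product_module (fun i => G i n)),
  (fun n => product_map (fun i => d i n)), (product_map p); split.
- move=> n le_nk; apply: Gproj_product => i.
  by have [GP _ _ _ _] := dp i; exact: GP.
- move=> n lt_kn x; apply/ffunP => i; rewrite product_zeroE.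
  by have [_ G0 _ _ _] := dp i; exact: G0.
- move=> y; apply/product_map_image => i.
  by have [_ _ pS _ _] := dp i; exact: pS.
- by apply: product_exact => i; have [] := dp i.
- by move=> n; apply: product_exact => i; have [] := dp i.
Qed.

(** Summing the inclusions of the components gives an isomorphism [t] from their product to [N]. *)
Lemma resolution_of_components k (N : lmodType S) :
  (forall i, has_Gproj_resolution k (component i N)) ->
  has_Gproj_resolution k N.
Proof.
move/resolution_product.
have idE (x : N) : \sum_i val (component_proj i x) = x.
  by rewrite -scaler_suml sum_ring_inj1 scale1r.
pose t := copair (fun i => idfun : {linear component i N -> component i N}).
apply: (@resolution_iso _ _ _ _ t) => [|y]; last first.
  exists (finfun (fun i => component_proj i y)).
  by rewrite -[RHS]idE; apply: eq_bigr => i _; rewrite ffunE.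
(* Injectivity of [t]: projecting to component [i] recovers [x i], because [e i] kills the
   components with index different from [i]. *)
have tK (x : product_module (fun i => component i N)) i :
    component_proj i (t x) = x i.
  rewrite linear_sum_inj.
  have -> : \sum_j t (module_inj (x j)) = \sum_j val (x j).
    by apply: eq_bigr => j _; rewrite copair_inj.
  apply: val_inj => /=; rewrite scaler_sumr (bigD1 i) //= idem_component.
  rewrite big1 ?addr0 // => j ij.
  by rewrite component_val_scale ring_inj_out 1?eq_sym // scale0r.
by move=> x y xy; apply/ffunP => i; rewrite -tK xy tK.
Qed.

Lemma resolution_product_ring k :
  (forall M : lmodType S, has_Gproj_resolution k M) <->
  (forall i (M : lmodType (R i)), has_Gproj_resolution k M).
Proof.
split=> [res i M|res M]; first exact/resolution_restriction/res.
by apply: resolution_of_components => i; exact: res.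
Qed.

End Product.

(** * Dimensions as elements of [\bar int] *)

(** The range of the dimensions. Here an element is determined by its natural upper bounds, which
    fails among the nonpositive elements of [\bar int]. *)
Definition nat_ereal : set (\bar int) :=
  [set x | x = +oo%E \/ exists n : nat, x = n%:Z%:E].

Lemma nat_ereal_ge0 x : nat_ereal x -> (0 <= x)%E.
Proof. by move=> [->|[n ->]]; rewrite ?leey // lee_fin. Qed.

Lemma nat_ereal_of_ge0 x : (0 <= x)%E -> nat_ereal x.
Proof.
by case: x => [[n|n]| |] // _; [right; exists n | left].
Qed.

Lemma nat_ereal_eq x y : nat_ereal x -> nat_ereal y ->
  (forall k : nat, (x <= k%:Z%:E)%E <-> (y <= k%:Z%:E)%E) -> x = y.
Proof.
move=> [->|[a ->]] [->|[b ->]] xy //.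
- by have /xy := lexx (b%:Z%:E : \bar int)%E.
- by have /xy := lexx (a%:Z%:E : \bar int)%E.
- by apply/le_anti/andP; split; [apply/xy|apply/xy]; rewrite lexx.
Qed.

(** [supremum] falls back on its default when no least upper bound exists, so existence has to be
    proved in [\bar int]. *)
Lemma nat_supremumP (A : set (\bar int)) :
  (A !=set0)%classic -> (A `<=` nat_ereal)%classic ->
  supremums A (supremum -oo%E A) /\ nat_ereal (supremum -oo%E A).
Proof.
move=> A0 AN; have [a Aa] := A0; have a0 := nat_ereal_ge0 (AN _ Aa).
have supA : supremums A (supremum -oo%E A).
  rewrite /supremum; case: ifPn => [/eqP AE|_].
    by rewrite AE in A0; case: A0.
  suff [s ?] : exists s, supremums A s by case: xgetP => // /(_ s).
  (* The least upper bound is the smallest natural one if there is any, and [+oo] otherwise; any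
     upper bound dominates [a], so it is nonnegative. *)
  have [[k kA]|nA] := pselect (exists k : nat, ubound A k%:Z%:E).
    have exk : exists k : nat, `[< ubound A k%:Z%:E >]
      by exists k; apply/asboolP.
    exists (ex_minn exk)%:Z%:E; case: ex_minnP => n /asboolP nA nmin.
    split=> // u uA; have [->|[l uE]] := nat_ereal_of_ge0 (le_trans a0 (uA _ Aa)).
      by rewrite leey.
    by rewrite uE lee_fin lez_nat nmin //; apply/asboolP; rewrite -uE.
  exists +oo%E; split=> [x _|u uA]; first by rewrite leey.
  have [->//|[l uE]] := nat_ereal_of_ge0 (le_trans a0 (uA _ Aa)).
  by case: nA; exists l; rewrite -uE.
by split=> //; apply: nat_ereal_of_ge0; exact: le_trans a0 (supA.1 _ Aa).
Qed.

Lemma nat_supremum_le (A : set (\bar int)) y :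
  (A !=set0)%classic -> (A `<=` nat_ereal)%classic ->
  (supremum -oo%E A <= y)%E <-> ubound A y.
Proof.
move=> A0 AN; have [[ubA lubA] _] := nat_supremumP A0 AN.
split=> [supy x /ubA xs|]; [exact: le_trans xs supy | exact: lubA].
Qed.

Section Dimensions.
Variable R : comPzRingType.

Lemma Gpd_spec (M : lmodType R) :
  (Gpd M = +oo%E /\ (forall k, ~ has_Gproj_resolution k M)) \/
  exists n : nat, [/\ Gpd M = n%:Z%:E, has_Gproj_resolution n M
    & forall k, has_Gproj_resolution k M -> (n <= k)%N].
Proof.
rewrite /Gpd; set A := (X in infimum _ X).
have [[k kM]|nM] := pselect (exists k, has_Gproj_resolution k M); last first.
  left; split=> [|k kM]; last by apply: nM; exists k.
  (* The infimum of the empty set is the default [+oo]. *)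
  suff -> : A = set0 by rewrite /infimum eqxx.
  by apply/seteqP; split=> // x [k kM _]; apply: nM; exists k.
have exk : exists k, `[< has_Gproj_resolution k M >] by exists k; apply/asboolP.
right; exists (ex_minn exk); case: ex_minnP => n /asboolP nM nmin.
have {}nmin l : has_Gproj_resolution l M -> (n <= l)%N.
  by move=> ?; apply/nmin/asboolP.
split=> //; rewrite /infimum ifF; last first.
  by apply/negbTE/set0P; exists k%:Z%:E, k.
(* Infima are unique, so the one selected by [xget] is [n], a lower bound attained in [A]. *)
apply: (@is_subset1_infimums _ _ A); last first.
  split=> [_ [l lM <-]|u uA]; first by rewrite lee_fin lez_nat nmin.
  by apply: uA; exists n.
case: xgetP => [x -> //|/(_ n%:Z%:E) []].
split=> [_ [l lM <-]|u uA]; first by rewrite lee_fin lez_nat nmin.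
by apply: uA; exists n.
Qed.

Lemma Gpd_le (M : lmodType R) (k : nat) :
  (Gpd M <= k%:Z%:E)%E <-> has_Gproj_resolution k M.
Proof.
have [[-> nM]|[n [-> nM nmin]]] := Gpd_spec M.
  by split=> // /nM.
rewrite lee_fin lez_nat; split; last exact: nmin.
by move/resolution_monotone; apply.
Qed.

Lemma Gpd_nat_ereal (M : lmodType R) : nat_ereal (Gpd M).
Proof.
by have [[-> _]|[n [-> _ _]]] := Gpd_spec M; [left|right; exists n].
Qed.

Lemma Gpd_set_neq0 :
  ([set x | exists M : lmodType R, Gpd M = x] !=set0)%classic.
Proof. by exists (Gpd (R^o : lmodType R)), (R^o : lmodType R). Qed.

Lemma Gpd_set_nat :
  ([set x | exists M : lmodType R, Gpd M = x] `<=` nat_ereal)%classic.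
Proof. by move=> _ [M <-]; exact: Gpd_nat_ereal. Qed.

Lemma Ggldim_nat_ereal : nat_ereal (Ggldim R).
Proof. exact: (nat_supremumP Gpd_set_neq0 Gpd_set_nat).2. Qed.

Lemma Ggldim_le (k : nat) : (Ggldim R <= k%:Z%:E)%E <->
  forall M : lmodType R, has_Gproj_resolution k M.
Proof.
rewrite (nat_supremum_le _ Gpd_set_neq0 Gpd_set_nat).
split=> [kub M|res _ [M <-]]; last exact/Gpd_le.
by apply/Gpd_le/kub; exists M.
Qed.

End Dimensions.

Theorem theorem3p1 (m : nat) (hm : (0 < m)%N) (R : 'I_m -> comPzRingType) :
  Ggldim {dffun forall i : 'I_m, R i}
  = supremum (-oo)%E (range (fun i : 'I_m => Ggldim (R i))).
Proof.
set A := range _.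
(* Positivity of [m] provides an index; an empty family would have supremum [-oo]. *)
have A0 : (A !=set0)%classic by exists (Ggldim (R (Ordinal hm))), (Ordinal hm).
have AN : (A `<=` nat_ereal)%classic
  by move=> _ [i _ <-]; exact: Ggldim_nat_ereal.
(* It remains to compare natural upper bounds [k]; on either side such a bound means that all
   modules concerned have resolutions of length [k]. *)
apply: nat_ereal_eq; [exact: Ggldim_nat_ereal|exact: (nat_supremumP A0 AN).2|].
move=> k; rewrite Ggldim_le resolution_product_ring (nat_supremum_le _ A0 AN).
split=> [res _ [i _ <-]|kub i]; first exact/Ggldim_le/res.
by apply/Ggldim_le/kub; exists i.
Qed.
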